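(* Let $\psi$ be an Orlicz function for which there exist constants $C>0$ and $x_0\ge 0$ such that $x\le C\,\psi(2x)$ and $\psi(2x)\le C\,\psi(x)$ for all $x\ge x_0$. Then there exist constants $c_\psi,C_\psi>0$ depending only on $\psi$ such that for every probability space $(Y,\mu)$, every $N\ge1$, and all independent random variables $X_1,\ldots,X_N$ on $(Y,\mu)$ with $\mathbb{E}[X_n]=0$ for $n=1,\ldots,N$, $$c_\psi\left\|\left(\sum_{n=1}^N|X_n|^2\right)^{1/2}\right\|_{L^\psi}\le\left\|\sum_{n=1}^N X_n\right\|_{L^\psi}\le C_\psi\left\|\left(\sum_{n=1}^N|X_n|^2\right)^{1/2}\right\|_{L^\psi}.$$
   Context: An Orlicz function (also called Young function) is a convex map $\psi:[0,\infty)\to[0,\infty)$ with $\psi(x)/x\to\infty$ as $x\to\infty$ and $\psi(x)/x\to 0$ as $x\to 0$. For a probability space $(Y,\mu)$ and a measurable function $f:Y\to\mathbb{R}$ or $\mathbb{C}$, the (Luxemburg) norm is $$\|f\|_{L^\psi}=\|f\|_{L^\psi(Y)}=\inf\left\{\lambda>0:\int_Y\psi\left(\frac{|f|}{\lambda}\right)d\mu\le 1\right\},$$ with value $\infty$ if no such $\lambda$ exists. The Orlicz space $L^\psi(Y)$ consists of the measurable $f$ with $\|f\|_{L^\psi(Y)}<\infty$.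
   Formalization: The condition ψ(0)=0 is added to the definition of an Orlicz function: without it ψ may jump at 0 (ψ(0)=5, ψ(x)=x² for x>0) and the upper inequality fails for two independent Rademacher variables. *)

(* Defs.v *)
From HB Require Import structures.
From mathcomp Require Import all_boot all_order all_algebra.
From mathcomp Require Import all_classical all_reals all_analysis.
From mathcomp Require Import complex.

Set Implicit Arguments.
Unset Strict Implicit.
Unset Printing Implicit Defensive.

Import Order.TTheory GRing.Theory Num.Theory.
Import numFieldNormedType.Exports.

Local Open Scope classical_set_scope.
Local Open Scope ring_scope.
Local Open Scope complex_scope.

(* Only the values of psi on [0, +oo[ matter. The condition psi 0 = 0 has to
   be stated: convexity on [0, +oo[ and psi x / x --> 0 give psi 0+ = 0 but
   allow psi to jump at the endpoint 0, and then the norm of the zero function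
   could be infinite. *)
Record orlicz_function (R : realType) (psi : R -> R) : Prop := OrliczFunction {
  orlicz_ge0 : forall x : R, 0 <= x -> 0 <= psi x ;
  orlicz_at0 : psi 0 = 0 ;
  orlicz_convex : convex_function (E := R^o) [set x : R | 0 <= x] psi ;
  orlicz_cvg_pinfty : psi x / x @[x --> +oo] --> +oo ;
  orlicz_cvg_0 : psi x / x @[x --> 0^'+] --> (0 : R)
}.

(* The modulus of a complex number as an element of R (Num.norm on R[i] takes
   its values in R[i]). *)
Definition cmod (R : realType) (z : R[i]) : R := ComplexField.Normc.normc z.

(* Infimum in \bar R, hence +oo when no lambda is admissible. *)
Definition luxemburg_norm (R : realType) (d : measure_display)
    (Y : measurableType d) (P : probability Y R) (psi : R -> R)
    (f : Y -> R[i]) : \bar R :=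
  ereal_inf [set lambda%:E | lambda in
    [set lambda : R | 0 < lambda /\
       (\int[P]_y (psi (cmod (f y) / lambda))%:E <= 1)%E]].

(* R[i] is identified, as a measurable space, with R * R. *)
Definition complex_pair (R : realType) (z : R[i]) : R * R :=
  (complex.Re z, complex.Im z).

Definition complex_measurable (R : realType) (d : measure_display)
    (Y : measurableType d) (f : Y -> R[i]) : Prop :=
  measurable_fun [set: Y] (fun y => complex_pair (f y)).

Definition complex_integrable (R : realType) (d : measure_display)
    (Y : measurableType d) (P : probability Y R) (f : Y -> R[i]) : Prop :=
  P.-integrable [set: Y] (fun y => (complex.Re (f y))%:E) /\
  P.-integrable [set: Y] (fun y => (complex.Im (f y))%:E).

(* Meaningful when f is complex_integrable. *)
Definition complex_expectation (R : realType) (d : measure_display)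
    (Y : measurableType d) (P : probability Y R) (f : Y -> R[i]) : R[i] :=
  fine 'E_P[(fun y => complex.Re (f y))] +i*
  fine 'E_P[(fun y => complex.Im (f y))].

Definition complex_independent (R : realType) (d : measure_display)
    (Y : measurableType d) (P : probability Y R) (N : nat)
    (X : 'I_N -> Y -> R[i]) : Prop :=
  forall (J : {set 'I_N}) (A : 'I_N -> set (R * R)),
    (forall n, n \in J -> measurable (A n)) ->
    P (\bigcap_(n in [set` J]) [set y | A n (complex_pair (X n y))]) =
    (\prod_(n in J) P [set y | A n (complex_pair (X n y))])%E.

Definition square_function (R : realType) (Y : Type) (N : nat)
    (X : 'I_N -> Y -> R[i]) (y : Y) : R :=
  Num.sqrt (\sum_(n < N) cmod (X n y) ^+ 2).

(* Main.v *)
(* Both inequalities follow from the pointwise Khintchine inequality for signed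
   sums, once random signs can be inserted. For independent centered X_n, Jensen's
   inequality shows that discarding some of the summands does not increase
   E psi(|sum X_n|). A signed sum is a difference of two complementary subsums,
   so for every fixed choice of signs E psi(|sum e_n X_n| / 2) <= E psi(|sum X_n|),
   and conversely since the e_n X_n are again independent and centered. Averaging
   over the signs and applying Khintchine at each point of Y compares both sides
   with the square function; the upper bound uses the doubling condition, which
   makes psi of polynomial growth above x0. *)

Require Import Defs.
From mathcomp Require Import all_boot all_order all_algebra.
From mathcomp Require Import all_classical all_reals all_analysis.
From mathcomp Require Import measurable_realfun complex ring lra.

Set Implicit Arguments.
Unset Strict Implicit.

Import Order.TTheory GRing.Theory Num.Theory.
Import numFieldNormedType.Exports.

Local Open Scope classical_set_scope.
Local Open Scope ring_scope.
Local Open Scope complex_scope.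

(** * Convexity, supporting lines and growth of Orlicz functions *)

Section orlicz.
Context (R : realType) (psi : R -> R) (psiP : orlicz_function psi).

Lemma orlicz_conv (t x y : R) : 0 <= t -> t <= 1 -> 0 <= x -> 0 <= y ->
  psi (t * x + (1 - t) * y) <= t * psi x + (1 - t) * psi y.
Proof.
move=> t0 t1 x0 y0.
have := orlicz_convex psiP (Itv01 t0 t1).
move=> /(_ x y); rewrite !inE/= => /(_ x0 y0).
by rewrite !convRE.
Qed.

(** Convexity at [a], seen as the combination of [x] and [y] with weight [(y - a) / (y - x)],
    cleared of denominators; comparisons of chord slopes on both sides of [a] follow from it. *)
Lemma orlicz_chord (x a y : R) : 0 <= x -> x < a -> a < y ->
  psi a * (y - x) <= (y - a) * psi x + (a - x) * psi y.
Proof.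
move=> x0 xa ay; have yx : 0 < y - x by lra.
have t0 : 0 <= (y - a) / (y - x) by apply: divr_ge0; lra.
have t1 : (y - a) / (y - x) <= 1 by rewrite ler_pdivrMr//; lra.
have := @orlicz_conv _ x y t0 t1 x0 (ltW (le_lt_trans x0 (lt_trans xa ay))).
have -> : (y - a) / (y - x) * x + (1 - (y - a) / (y - x)) * y = a.
  by field; lra.
have -> : (y - a) / (y - x) * psi x + (1 - (y - a) / (y - x)) * psi y =
   ((y - a) * psi x + (a - x) * psi y) / (y - x).
  by field; lra.
by rewrite ler_pdivlMr.
Qed.

Lemma orlicz_scale (t x : R) : 0 <= t -> t <= 1 -> 0 <= x ->
  psi (t * x) <= t * psi x.
Proof.
move=> t0 t1 x0; have := @orlicz_conv t x 0 t0 t1 x0 (lexx _).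
by rewrite (orlicz_at0 psiP) !mulr0 !addr0.
Qed.

Lemma orlicz_mono (x y : R) : 0 <= x -> x <= y -> psi x <= psi y.
Proof.
move=> x0 xy; have [->//|y0] := eqVneq x y.
have yp : 0 < y by rewrite (le_lt_trans x0)// lt_neqAle y0.
have t1 : x / y <= 1 by rewrite ler_pdivrMr// mul1r.
have := @orlicz_scale _ y (divr_ge0 x0 (ltW yp)) t1 (ltW yp).
rewrite divfK ?gt_eqF// => /le_trans; apply.
by rewrite ler_piMl// (orlicz_ge0 psiP)// ltW.
Qed.

Lemma orlicz_half (x y : R) : 0 <= x -> 0 <= y ->
  psi ((x + y) / 2) <= (psi x + psi y) / 2.
Proof.
move=> x0 y0; have := @orlicz_conv (1/2) x y.
have -> : 1 / 2 * x + (1 - 1 / 2) * y = (x + y) / 2 by lra.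
have -> : 1 / 2 * psi x + (1 - 1 / 2) * psi y = (psi x + psi y) / 2 by lra.
by apply; lra.
Qed.

(** The slope is the infimum of the chord slopes to the right of [a]. By [orlicz_chord] each chord
    slope to the left is a lower bound of these, so the line stays below [psi] on both sides; the
    left chord from 0 has slope [psi a / a], which gives [0 <= m]. *)
Lemma orlicz_support (a : R) : 0 < a ->
  exists2 m : R, 0 <= m & forall x : R, 0 <= x -> psi a + m * (x - a) <= psi x.
Proof.
move=> a0.
pose S := [set (psi y - psi a) / (y - a) | y in [set y | a < y]].
have Slb x : 0 <= x -> x < a -> lbound S ((psi a - psi x) / (a - x)).
  move=> x0 xa _ [y /= ay <-].
  rewrite ler_pdivlMr ?subr_gt0// mulrAC ler_pdivrMr ?subr_gt0//.
  by have := @orlicz_chord x a y x0 xa ay; lra.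
have S0 : S !=set0.
  by exists ((psi (a + 1) - psi a) / (a + 1 - a)), (a + 1) => //=; lra.
have hS : has_lbound S by exists ((psi a - psi 0) / (a - 0)); exact: Slb.
exists (inf S).
  apply: le_trans (lb_le_inf S0 (Slb 0 (lexx _) a0)).
  rewrite subr0 (orlicz_at0 psiP) subr0 divr_ge0 ?(orlicz_ge0 psiP)//; exact: ltW.
move=> x x0; have [xa|ax|->] := ltgtP x a; last by rewrite subrr mulr0 addr0.
- have := lb_le_inf S0 (Slb x x0 xa).
  by rewrite ler_pdivrMr ?subr_gt0//; lra.
- have : inf S <= (psi x - psi a) / (x - a) by apply: (ge_inf hS); exists x.
  by rewrite ler_pdivlMr ?subr_gt0//; lra.
Qed.

(** For [t <= 1] monotonicity suffices and accounts for the summand 1. For larger [t] the doubling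
    condition is iterated: each halving of the argument costs a factor [2 ^+ p], and the 2 in
    [(2 * t) ^+ p] pays for the last, incomplete doubling. *)
Lemma orlicz_doubling_growth (C x0 m t : R) (p : nat) :
  0 <= x0 -> (forall x, x0 <= x -> psi (2 * x) <= C * psi x) ->
  C <= 2 ^+ p -> x0 <= m -> 0 <= t ->
  psi (t * m) <= (1 + (2 * t) ^+ p) * psi m.
Proof.
move=> x00 dbl Cp xm t0.
have m0 : 0 <= m := le_trans x00 xm.
have pm0 : 0 <= psi m := orlicz_ge0 psiP m0.
have [t1|t1] := leP t 1.
  apply: (@le_trans _ _ (psi m)).
    by apply: orlicz_mono; [exact: mulr_ge0|rewrite ler_piMl].
  by rewrite ler_peMl// lerDl exprn_ge0// mulr_ge0.
(* The induction runs on the number [k] of doublings that reach [s]; [Num.bound t] is one that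
   reaches [t]. *)
suff large k s : 1 <= s -> s <= 2 ^+ k -> psi (s * m) <= (2 * s) ^+ p * psi m.
  apply: (@le_trans _ _ ((2 * t) ^+ p * psi m)).
    by apply: (large (Num.bound t)); [exact: ltW|exact/ltW/upper_nthrootP].
  by rewrite ler_wpM2r// lerDr.
elim: k s => [|k IH] s s1; first rewrite expr0 => sle.
  have -> : s = 1 by apply/le_anti; rewrite s1 sle.
  by rewrite mul1r mulr1 ler_peMl// exprn_ege1//; lra.
rewrite exprS => sle.
have dblp x : x0 <= x -> psi (2 * x) <= 2 ^+ p * psi x.
  move=> xx; apply: (le_trans (dbl _ xx)).
  by rewrite ler_wpM2r// (orlicz_ge0 psiP)// (le_trans x00).
have [s2|s2] := leP s 2.
  apply: (@le_trans _ _ (psi (2 * m))).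
    by apply: orlicz_mono; [apply: mulr_ge0; lra|rewrite ler_wpM2r].
  apply: (le_trans (dblp _ xm)).
  by rewrite ler_wpM2r// lerXn2r ?nnegrE; lra.
have -> : s * m = 2 * (s / 2 * m) by field.
apply: (le_trans (dblp _ _)).
  by apply: (le_trans xm); rewrite ler_peMl//; lra.
rewrite exprMn -[leRHS]mulrA ler_wpM2l ?exprn_ge0//.
have -> : s = 2 * (s / 2) by field.
have -> : 2 * (s / 2) / 2 = s / 2 by field.
by apply: IH; lra.
Qed.

End orlicz.

(** * The modulus of complex numbers and its square *)

Section modulus.
Context {R : realType}.
Implicit Types z w : R[i].

Definition sqmod z : R := complex.Re z ^+ 2 + complex.Im z ^+ 2.

Lemma sqmod_ge0 z : 0 <= sqmod z.
Proof. by rewrite addr_ge0// sqr_ge0. Qed.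

Lemma cmodE z : cmod z = Num.sqrt (sqmod z).
Proof. by case: z. Qed.

Lemma cmod_ge0 z : 0 <= cmod z.
Proof. by rewrite cmodE sqrtr_ge0. Qed.

Lemma sqr_cmod z : cmod z ^+ 2 = sqmod z.
Proof. by rewrite cmodE sqr_sqrtr// sqmod_ge0. Qed.

Lemma cmodD z w : cmod (z + w) <= cmod z + cmod w.
Proof. exact: le_normcD. Qed.

Lemma cmodN z : cmod (- z) = cmod z.
Proof. exact: normcN. Qed.

Lemma cmodR (r : R) : cmod r%:C = `|r|.
Proof. by rewrite cmodE /sqmod/= expr0n addr0 sqrtr_sqr. Qed.

Lemma ReD z w : complex.Re (z + w) = complex.Re z + complex.Re w.
Proof. by case: z; case: w. Qed.

Lemma ImD z w : complex.Im (z + w) = complex.Im z + complex.Im w.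
Proof. by case: z; case: w. Qed.

Lemma ReN z : complex.Re (- z) = - complex.Re z.
Proof. by case: z. Qed.

Lemma ImN z : complex.Im (- z) = - complex.Im z.
Proof. by case: z. Qed.

Lemma cmod_le_ReIm z : cmod z <= `|complex.Re z| + `|complex.Im z|.
Proof.
rewrite cmodE -[leRHS]ger0_norm ?addr_ge0// -sqrtr_sqr ler_wsqrtr//.
by rewrite sqrrD !real_normK ?num_real// /sqmod lerD2r lerDl mulrn_wge0// mulr_ge0.
Qed.

End modulus.

(** * Moments of random signed sums with a free base point *)

Section rademacher.
Context {R : realType}.
Implicit Types (F G : R[i] -> R) (a : R[i]) (x : nat -> R[i]).

(* The expectation of [F (a + \sum_(i < n) e_i x_i)] over uniform signs e_i. *)
Fixpoint rademacher_mean n F a x : R :=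
  if n is n'.+1 then
    (rademacher_mean n' F (a + x n') x + rademacher_mean n' F (a - x n') x) / 2
  else F a.

Lemma rademacher_mean_ge0 n F a x : (forall z, 0 <= F z) ->
  0 <= rademacher_mean n F a x.
Proof.
move=> F0; elim: n a => [|n IH] a //=.
by apply: divr_ge0 => //; apply: addr_ge0.
Qed.

Lemma rademacher_mean_le n F G a x : (forall z, F z <= G z) ->
  rademacher_mean n F a x <= rademacher_mean n G a x.
Proof.
move=> FG; elim: n a => [|n IH] a //=.
by have := IH (a + x n); have := IH (a - x n); lra.
Qed.

Lemma rademacher_mean_affine n F G (c k l : R) a x :
  rademacher_mean n (fun z => c + k * F z + l * G z) a x =
  c + k * rademacher_mean n F a x + l * rademacher_mean n G a x.
Proof. by elim: n a => [|n IH] a //=; rewrite !IH; field. Qed.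

Lemma rademacher_mean_sqmod n a x :
  rademacher_mean n sqmod a x = sqmod a + \sum_(i < n) sqmod (x i).
Proof.
elim: n a => [|n IH] a /=; first by rewrite big_ord0 addr0.
by rewrite !IH big_ord_recr/= /sqmod !(ReD, ImD, ReN, ImN); field.
Qed.

(** Fourth moment. The base point [a] makes the induction possible; at [a = 0] only
    [3 (\sum |x_i|^2)^2] remains. In the step, the terms linear in the real inner product [D] of [a]
    and [x n] cancel between the two signs, and Cauchy-Schwarz controls [D ^+ 2]. *)
Lemma rademacher_mean_sqmod2 n a x :
  rademacher_mean n (fun z => sqmod z ^+ 2) a x <=
  sqmod a ^+ 2 + 6 * sqmod a * (\sum_(i < n) sqmod (x i))
  + 3 * (\sum_(i < n) sqmod (x i)) ^+ 2.
Proof.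
elim: n a => [|n IH] a /=; first by rewrite big_ord0; lra.
rewrite big_ord_recr/=; set s := \sum_(i < n) _.
have := IH (a + x n); have := IH (a - x n); rewrite -/s.
set D := complex.Re a * complex.Re (x n) + complex.Im a * complex.Im (x n).
have -> : sqmod (a + x n) = sqmod a + sqmod (x n) + 2 * D.
  by rewrite /D /sqmod ReD ImD; ring.
have -> : sqmod (a - x n) = sqmod a + sqmod (x n) - 2 * D.
  by rewrite /D /sqmod ReD ImD ReN ImN; ring.
have : D ^+ 2 <= sqmod a * sqmod (x n).
  rewrite /D /sqmod -subr_ge0 [leRHS](_ : _ = (complex.Re a * complex.Im (x n) -
    complex.Im a * complex.Re (x n)) ^+ 2) ?sqr_ge0//; ring.
have := sqr_ge0 (sqmod (x n)).
move: (rademacher_mean _ _ _ _) (rademacher_mean _ _ _ _) => M1 M2.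
move: (sqmod a) (sqmod (x n)) D s => A X D s X2 DAX h1 h2.
rewrite -subr_ge0.
have -> : A ^+ 2 + 6 * A * (s + X) + 3 * (s + X) ^+ 2 - (M1 + M2) / 2 =
  (((A + X - 2 * D) ^+ 2 + 6 * (A + X - 2 * D) * s + 3 * s ^+ 2 - M2)
  + ((A + X + 2 * D) ^+ 2 + 6 * (A + X + 2 * D) * s + 3 * s ^+ 2 - M1)) / 2
  + 4 * (A * X - D ^+ 2) + 2 * X ^+ 2 by field.
by apply: addr_ge0; [apply: addr_ge0|]; lra.
Qed.

(** Subgaussian bound for a real linear form of the signed sum: each sign contributes a factor
    [cosh b <= expR (2 * b ^+ 2)]. *)
Lemma rademacher_mean_exp n (u v : R) a x :
  rademacher_mean n
    (fun z => expR (u * complex.Re z + v * complex.Im z)) a x <=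
  expR (u * complex.Re a + v * complex.Im a +
    2 * \sum_(i < n) (u * complex.Re (x i) + v * complex.Im (x i)) ^+ 2).
Proof.
have cosh_le (b : R) : (expR b + expR (- b)) / 2 <= expR (2 * b ^+ 2).
  wlog b0 : b / 0 <= b.
    move=> H; have [/H//|b0] := leP 0 b.
    by have := H (- b); rewrite opprK sqrrN addrC; apply; lra.
  (* Above 1/2 one has [b <= 2 * b ^+ 2], so both exponentials are small enough. Below, the sum of
     the exponentials is at most [2 / (1 - b ^+ 2)], hence at most [2 + 4 * b ^+ 2] because
     [b ^+ 2 <= 1 / 4]. *)
  have [b2|b2] := leP b (1 / 2); last first.
    have : expR b <= expR (2 * b ^+ 2) by rewrite ler_expR; nra.
    have : expR (- b) <= expR b by rewrite ler_expR; lra.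
    lra.
  (* [expR b <= 1 / (1 - b)], and symmetrically. *)
  have h1 : expR b * (1 - b) <= 1.
    have := expR_ge1Dx (- b); have := expR_gt0 b.
    have : expR b * expR (- b) = 1 by rewrite -expRD subrr expR0.
    nra.
  have h2 : expR (- b) * (1 + b) <= 1.
    have := expR_ge1Dx b; have := expR_gt0 (- b).
    have : expR b * expR (- b) = 1 by rewrite -expRD subrr expR0.
    nra.
  apply: (le_trans _ (expR_ge1Dx _)).
  have h3 : (expR b + expR (- b)) * (1 - b ^+ 2) <= 2 by nra.
  have b22 : b ^+ 2 <= 1 / 4 by nra.
  have : 0 <= b ^+ 2 by rewrite sqr_ge0.
  move: (expR b + expR (- b)) (b ^+ 2) h3 b22 => e q h3 q1 q0.
  have : 0 <= (2 + 4 * q - e) * (1 - q) by nra.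
  by rewrite pmulr_lge0; lra.
elim: n a => [|n IH] a /=; first by rewrite big_ord0 mulr0 addr0.
rewrite big_ord_recr/=; set s := \sum_(i < n) _.
have := IH (a + x n); have := IH (a - x n); rewrite -/s.
rewrite !(ReD, ImD, ReN, ImN).
set b := u * complex.Re (x n) + v * complex.Im (x n).
set c := u * complex.Re a + v * complex.Im a + 2 * s.
have -> : u * (complex.Re a - complex.Re (x n)) +
  v * (complex.Im a - complex.Im (x n)) + 2 * s = c + - b.
  by rewrite /c /b; ring.
have -> : u * (complex.Re a + complex.Re (x n)) +
  v * (complex.Im a + complex.Im (x n)) + 2 * s = c + b.
  by rewrite /c /b; ring.
have -> : u * complex.Re a + v * complex.Im a + 2 * (s + b ^+ 2) =
  c + 2 * b ^+ 2 by rewrite /c; ring.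
rewrite (expRD c b) (expRD c (- b)) (expRD c (2 * b ^+ 2)).
have := ler_wpM2l (expR_ge0 c) (cosh_le b); lra.
Qed.

End rademacher.

(** * Khintchine inequalities for an Orlicz function *)

Section khintchine.
Context {R : realType} (psi : R -> R) (psiP : orlicz_function psi).
Implicit Types (x : nat -> R[i]).

Lemma orlicz_cmod_ge0 (z : R[i]) (l : R) : 0 < l -> 0 <= psi (cmod z / l).
Proof.
by move=> l0; apply: (orlicz_ge0 psiP); rewrite divr_ge0 ?cmod_ge0// ltW.
Qed.

(** The supporting line of [psi] reduces the claim to a lower bound on the first moment. With [t]
    the modulus of the signed sum over [q], the mean of [t ^+ 2] is 1 and that of [t ^+ 4] at most
    3, so [t >= t^2 - 4/27 t^4] yields the constant [1 - 3 * 4/27 = 5/9]. *)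
Lemma khintchine_lower n (l : R) x : 0 < l ->
  psi (5 / 9 * (Num.sqrt (\sum_(i < n) sqmod (x i)) / l)) <=
  rademacher_mean n (fun z => psi (cmod z / l)) 0 x.
Proof.
move=> l0; set s := \sum_(i < n) _.
have s_ge0 : 0 <= s by apply: sumr_ge0 => i _; exact: sqmod_ge0.
set q : R := Num.sqrt s.
have := sqrtr_ge0 s; rewrite -/q le_eqVlt => /predU1P[<-|q0].
  by rewrite mul0r mulr0 (orlicz_at0 psiP) rademacher_mean_ge0// => z; exact: orlicz_cmod_ge0.
have sE : s = q ^+ 2 by rewrite sqr_sqrtr.
pose a : R := 5 / 9 * (q / l).
have a0 : 0 < a by rewrite mulr_gt0 ?divr_gt0.
have [m m0 mP] := orlicz_support psiP a0.
(* [t >= t^2 - 4/27 t^4], i.e. [t (t - 3/2)^2 (t + 3) >= 0], for t = |z| / q. *)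
have cmod_ge z : sqmod z / q - 4 / 27 * (sqmod z ^+ 2 / q ^+ 3) <= cmod z.
  rewrite -sqr_cmod; have := cmod_ge0 z; move: (cmod z) => r r0.
  have -> : r ^+ 2 / q - 4 / 27 * (r ^+ 2 ^+ 2 / q ^+ 3) =
    r - 4 / 27 * (r * (r - 3 / 2 * q) ^+ 2 * (r + 3 * q)) / q ^+ 3.
    by field; lra.
  rewrite gerBl divr_ge0 ?exprn_ge0 ?(ltW q0)//.
  have r3 : 0 <= r + 3 * q by lra.
  have c0 : 0 <= 4 / 27 :> R by lra.
  exact: (mulr_ge0 c0 (mulr_ge0 (mulr_ge0 r0 (sqr_ge0 _)) r3)).
(* A pointwise minorant that involves [z] only through its second and fourth powers, whose means are
   known. *)
have low z : psi a - m * a + (m / (l * q)) * sqmod z +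
    (- (4 * m / (27 * l * q ^+ 3))) * sqmod z ^+ 2 <= psi (cmod z / l).
  apply: le_trans (mP _ _); last by rewrite divr_ge0 ?cmod_ge0// ltW.
  have := ler_wpM2l (divr_ge0 m0 (ltW l0)) (cmod_ge z).
  have -> : m / l * (sqmod z / q - 4 / 27 * (sqmod z ^+ 2 / q ^+ 3)) =
    m / (l * q) * sqmod z + - (4 * m / (27 * l * q ^+ 3)) * sqmod z ^+ 2.
    by field; lra.
  have -> : m / l * cmod z = m * (cmod z / l) by field; lra.
  lra.
have := rademacher_mean_le n 0 x low.
rewrite rademacher_mean_affine rademacher_mean_sqmod -/s.
apply: le_trans.
have := rademacher_mean_sqmod2 n 0 x.
have -> : sqmod (0 : R[i]) = 0 by rewrite /sqmod/= expr0n addr0.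
rewrite -/s !(mulr0, mul0r) expr0n/= !add0r sE => h4.
have k0 : 0 <= 4 * m / (27 * l * q ^+ 3).
  by rewrite divr_ge0 ?mulr_ge0 ?exprn_ge0 ?(ltW l0) ?(ltW q0).
have := ler_wpM2l k0 h4.
have -> : 4 * m / (27 * l * q ^+ 3) * (3 * q ^+ 2 ^+ 2) = 4 / 9 * (m * (q / l)).
  by field; lra.
have -> : m / (l * q) * q ^+ 2 = m * (q / l) by field; lra.
rewrite /a; lra.
Qed.

Lemma rademacher_moment n (p : nat) (M : R) x : 0 < M ->
  \sum_(i < n) sqmod (x i) <= M ^+ 2 ->
  rademacher_mean n (fun z => (cmod z / M) ^+ p.+1) 0 x <=
  2 ^+ p.+1 * p.+1`!%:R * (4 * expR 2).
Proof.
move=> M0 sM; set f : R := p.+1`!%:R.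
have f0 : 0 < f by rewrite ltr0n fact_gt0.
have pow_le (t : R) : `|t| ^+ p.+1 <= f * (expR t + expR (- t)).
  have : `|t| ^+ p.+1 / f <= expR `|t|.
    by have := expR_ge1Dxn p (normr_ge0 t); rewrite -/f; lra.
  rewrite ler_pdivrMr// mulrC => /le_trans; apply.
  rewrite ler_wpM2l ?(ltW f0)//; have := expR_ge0 t; have := expR_ge0 (- t).
  by case: (ger0P t); lra.
pose e u v (z : R[i]) := expR (u * complex.Re z + v * complex.Im z).
(* By Cauchy-Schwarz the sum in the exponent is at most [(u ^+ 2 + v ^+ 2) * M ^+ 2 = 1]. *)
have mean_e u v : u ^+ 2 + v ^+ 2 = (M ^+ 2)^-1 ->
    rademacher_mean n (e u v) 0 x <= expR 2.
  move=> uv; apply: (le_trans (rademacher_mean_exp _ _ _ _ _)).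
  rewrite /= !mulr0 !add0r ler_expR -[leRHS]mulr1 ler_wpM2l//.
  apply: (@le_trans _ _ (\sum_(i < n) (u ^+ 2 + v ^+ 2) * sqmod (x i))).
    apply: ler_sum => i _; rewrite /sqmod -subr_ge0 [leRHS](_ : _ =
      (u * complex.Im (x i) - v * complex.Re (x i)) ^+ 2) ?sqr_ge0//; ring.
  by rewrite -mulr_sumr uv mulrC ler_pdivrMr ?mul1r// exprn_gt0.
pose k : R := 2 ^+ p.+1 * f.
have k0 : 0 <= k by rewrite mulr_ge0 ?exprn_ge0// ltW.
apply: (@le_trans _ _ (rademacher_mean n (fun z =>
   0 + k * (0 + 1 * e M^-1 0 z + 1 * e (- M^-1) 0 z) +
   k * (0 + 1 * e 0 M^-1 z + 1 * e 0 (- M^-1) z)) 0 x)).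
  apply: rademacher_mean_le => z.
  pose A := complex.Re z / M; pose B := complex.Im z / M.
  have zAB : cmod z / M <= `|A| + `|B|.
    rewrite /A /B !normrM !(gtr0_norm (_ : 0 < M^-1)) ?invr_gt0// -mulrDl.
    by rewrite ler_wpM2r ?invr_ge0 ?(ltW M0)// cmod_le_ReIm.
  have -> : e M^-1 0 z = expR A by rewrite /e mul0r addr0 mulrC.
  have -> : e (- M^-1) 0 z = expR (- A) by rewrite /e mul0r addr0 mulNr mulrC.
  have -> : e 0 M^-1 z = expR B by rewrite /e mul0r add0r mulrC.
  have -> : e 0 (- M^-1) z = expR (- B) by rewrite /e mul0r add0r mulNr mulrC.
  rewrite !add0r !mul1r /k -!mulrA -mulrDr.
  apply: (@le_trans _ _ (2 ^+ p.+1 * (`|A| ^+ p.+1 + `|B| ^+ p.+1))); last first.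
    by rewrite ler_wpM2l ?exprn_ge0// lerD.
  apply: (@le_trans _ _ ((`|A| + `|B|) ^+ p.+1)).
    by rewrite lerXn2r ?nnegrE ?addr_ge0// divr_ge0 ?cmod_ge0// ltW.
  wlog AB : A B {zAB} / `|A| <= `|B|.
    move=> H; have [/H//|/ltW/H] := leP `|A| `|B|.
    by rewrite [`|B| + _]addrC [`|B| ^+ _ + _]addrC.
  apply: (@le_trans _ _ ((2 * `|B|) ^+ p.+1)).
    by rewrite lerXn2r ?nnegrE ?addr_ge0 ?mulr_ge0//; lra.
  by rewrite exprMn ler_wpM2l ?exprn_ge0// lerDr exprn_ge0.
rewrite !rademacher_mean_affine.
have V2 : (M^-1) ^+ 2 = (M ^+ 2)^-1 by rewrite exprVn.
have h1 : rademacher_mean n (e M^-1 0) 0 x <= expR 2.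
  by apply: mean_e; rewrite V2 expr0n addr0.
have h2 : rademacher_mean n (e (- M^-1) 0) 0 x <= expR 2.
  by apply: mean_e; rewrite sqrrN V2 expr0n addr0.
have h3 : rademacher_mean n (e 0 M^-1) 0 x <= expR 2.
  by apply: mean_e; rewrite V2 expr0n add0r.
have h4 : rademacher_mean n (e 0 (- M^-1)) 0 x <= expR 2.
  by apply: mean_e; rewrite sqrrN V2 expr0n add0r.
rewrite -/k.
have := ler_wpM2l k0 (lerD (lerD h1 h2) (lerD h3 h4)).
lra.
Qed.

(** Doubling gives polynomial growth of degree [p], so [rademacher_moment] applies. Since doubling
    holds only above [x0], the scale [q / l] is raised to [m], and the price is the additive term
    [psi (x0 + 1)]. *)
Lemma khintchine_upper (C x0 : R) : 0 <= x0 ->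
  (forall t : R, x0 <= t -> psi (2 * t) <= C * psi t) ->
  exists2 B : R, 1 <= B & forall n (l : R) (x : nat -> R[i]), 0 < l ->
    rademacher_mean n (fun z => psi (cmod z / l)) 0 x <=
    B * (psi (Num.sqrt (\sum_(i < n) sqmod (x i)) / l) + psi (x0 + 1)).
Proof.
move=> x00 dbl.
(* A successor, because [rademacher_moment] treats the exponents [p.+1]. *)
pose p := (Num.bound `|C|).+1.
have Cp : C <= 2 ^+ p.
  by apply: (le_trans (ler_norm _)); apply/ltW/upper_nthrootP; exact: leqnSn.
pose K : R := 2 ^+ p * p`!%:R * (4 * expR 2).
have K0 : 0 <= K by apply: mulr_ge0; apply: mulr_ge0; rewrite ?exprn_ge0 ?expR_ge0.
exists (1 + 2 ^+ p * K); first by rewrite lerDl mulr_ge0// exprn_ge0.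
move=> n l x l0; set s := \sum_(i < n) _.
have s_ge0 : 0 <= s by apply: sumr_ge0 => i _; exact: sqmod_ge0.
set q : R := Num.sqrt s; have q_ge0 : 0 <= q by exact: sqrtr_ge0.
have ql0 : 0 <= q / l by rewrite divr_ge0// ltW.
(* Taking [x0 + 1] instead of [x0] keeps [m] positive even when [x0] and [q] vanish. *)
pose m : R := Num.max (q / l) (x0 + 1).
have m0 : 0 < m by rewrite lt_max; apply/orP; right; lra.
have xm : x0 <= m by rewrite le_max; apply/orP; right; lra.
have pm : psi m <= psi (q / l) + psi (x0 + 1).
  have := orlicz_ge0 psiP ql0; have : 0 <= psi (x0 + 1).
    by apply: (orlicz_ge0 psiP); lra.
  by rewrite /m; case: (leP (q / l) (x0 + 1)); lra.
have M0 : 0 < m * l by rewrite mulr_gt0.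
have sM : s <= (m * l) ^+ 2.
  rewrite -(sqr_sqrtr s_ge0) -/q lerXn2r ?nnegrE ?(ltW M0)//.
  by rewrite -ler_pdivrMr// le_max lexx.
apply: (@le_trans _ _ ((1 + 2 ^+ p * K) * psi m)); last first.
  by rewrite ler_wpM2l// addr_ge0// mulr_ge0// exprn_ge0.
(* Growth is applied to [cmod z / l = t * m] with [t = cmod z / (m * l)]; the zero summand gives the
   integrand the shape of [rademacher_mean_affine]. *)
apply: (@le_trans _ _ (rademacher_mean n (fun z => psi m +
    (2 ^+ p * psi m) * (cmod z / (m * l)) ^+ p + 0 * psi (cmod z / l)) 0 x)).
  apply: rademacher_mean_le => z; rewrite mul0r addr0.
  have -> : cmod z / l = cmod z / (m * l) * m by field; lra.
  apply: (le_trans (orlicz_doubling_growth psiP x00 dbl Cp xm _)).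
    by rewrite divr_ge0 ?cmod_ge0// ltW.
  rewrite exprMn; lra.
rewrite rademacher_mean_affine mul0r addr0.
have := rademacher_moment (Num.bound `|C|) M0 sM; rewrite -/p -/K => h.
have pm0 : 0 <= 2 ^+ p * psi m.
  by rewrite mulr_ge0 ?exprn_ge0// (orlicz_ge0 psiP)// ltW.
have := ler_wpM2l pm0 h; lra.
Qed.

End khintchine.

(** * Measurability of complex functions and of the averages *)

Section measurability.
Context {R : realType} (d : measure_display) (Y : measurableType d).
Implicit Types f g : Y -> R[i].

Lemma complex_measurableP f : complex_measurable f <->
  measurable_fun [set: Y] (fun y => complex.Re (f y)) /\
  measurable_fun [set: Y] (fun y => complex.Im (f y)).
Proof. exact: measurable_fun_pairP. Qed.

Lemma complex_measurable_cst (c : R[i]) : complex_measurable (fun _ : Y => c).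
Proof. exact: measurable_cst. Qed.

Lemma complex_measurableD f g : complex_measurable f -> complex_measurable g ->
  complex_measurable (fun y => f y + g y).
Proof.
move=> /complex_measurableP[f1 f2] /complex_measurableP[g1 g2].
apply/complex_measurableP; split.
- by under eq_fun do rewrite ReD; exact: measurable_funD.
- by under eq_fun do rewrite ImD; exact: measurable_funD.
Qed.

Lemma complex_measurableN f : complex_measurable f ->
  complex_measurable (fun y => - f y).
Proof.
move=> /complex_measurableP[f1 f2]; apply/complex_measurableP; split.
- by under eq_fun do rewrite ReN; exact: measurableT_comp.
- by under eq_fun do rewrite ImN; exact: measurableT_comp.
Qed.

Lemma complex_measurable_sum (I : Type) (r : seq I) (Q : pred I)
    (X : I -> Y -> R[i]) : (forall i, Q i -> complex_measurable (X i)) ->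
  complex_measurable (fun y => \sum_(i <- r | Q i) X i y).
Proof.
move=> mX; elim: r => [|i r IH].
  rewrite (_ : (fun y => _) = (fun=> 0)); first exact: complex_measurable_cst.
  by apply/funext => y; rewrite big_nil.
rewrite (_ : (fun y => _) =
  (fun y => if Q i then X i y + \sum_(j <- r | Q j) X j y
            else \sum_(j <- r | Q j) X j y)); last first.
  by apply/funext => y; rewrite big_cons.
by case Qi: (Q i) => //; apply: complex_measurableD => //; exact: mX.
Qed.

Lemma measurable_sqmod f : complex_measurable f ->
  measurable_fun [set: Y] (fun y => sqmod (f y)).
Proof.
move=> /complex_measurableP[f1 f2].
by apply: measurable_funD; apply: measurable_funX.
Qed.

Lemma measurable_sqrt (h : Y -> R) : measurable_fun [set: Y] h ->
  measurable_fun [set: Y] (fun y => Num.sqrt (h y)).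
Proof.
apply: measurableT_comp; apply: nondecreasing_measurable => // x y.
exact: ler_wsqrtr.
Qed.

Lemma complex_measurable_square_function N (X : 'I_N -> Y -> R[i]) :
  (forall n, complex_measurable (X n)) ->
  complex_measurable (fun y => (square_function X y)%:C).
Proof.
move=> mX; apply/complex_measurableP; split => /=; last exact: measurable_cst.
apply: measurable_sqrt; apply: measurable_sum => n.
rewrite (_ : (fun y => _) = (fun y => sqmod (X n y))).
  exact: measurable_sqmod.
by apply/funext => y; rewrite sqr_cmod.
Qed.

Lemma measurable_orlicz_cmod (psi : R -> R) (l : R) f : orlicz_function psi ->
  0 < l -> complex_measurable f ->
  measurable_fun [set: Y] (fun y => psi (cmod (f y) / l)).
Proof.
move=> psiP l0 mf.
(* The values of [psi] on the negative half-line are arbitrary. *)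
rewrite (_ : (fun y => _) =
  (fun t => psi (Num.max 0 t)) \o (fun y => cmod (f y) / l)); last first.
  by apply/funext => y /=; rewrite max_r// divr_ge0 ?cmod_ge0// ltW.
apply: measurableT_comp.
  apply: nondecreasing_measurable => // s t st; apply: (orlicz_mono psiP).
    by rewrite le_max lexx.
  by rewrite ge_max le_max lexx/= le_max st orbT.
apply: measurable_funM; last exact: measurable_cst.
under eq_fun do rewrite cmodE.
exact/measurable_sqrt/measurable_sqmod.
Qed.

Lemma measurable_rademacher_mean (F : R[i] -> R) n f (X : nat -> Y -> R[i]) :
  (forall g, complex_measurable g -> measurable_fun [set: Y] (F \o g)) ->
  complex_measurable f -> (forall i, complex_measurable (X i)) ->
  measurable_fun [set: Y] (fun y => rademacher_mean n F (f y) (X ^~ y)).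
Proof.
move=> mF mf mX; elim: n f mf => [|n IH] f mf /=; first exact: mF.
apply: measurable_funM; last exact: measurable_cst.
apply: measurable_funD; apply: IH; apply: complex_measurableD => //.
exact: complex_measurableN.
Qed.

End measurability.

(** * Adding an independent centered summand *)

Section jensen.
Context {R : realType} (psi : R -> R) (psiP : orlicz_function psi).
Context (d : measure_display) (Y : measurableType d) (P : probability Y R).

(** The supporting line of [psi] at [cmod u / l], combined with the projection of [u + V] onto the
    direction of [u], bounds the integrand below by a constant plus a real linear form in [V], and
    that form has mean zero. *)
Lemma jensen_translate (V : Y -> R[i]) (u : R[i]) (l : R) : 0 < l ->
  complex_measurable V -> complex_integrable P V ->
  complex_expectation P V = 0 ->
  ((psi (cmod u / l))%:E <= \int[P]_y (psi (cmod (u + V y) / l))%:E)%E.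
Proof.
move=> l0 mV [iRe iIm] /eqP; rewrite eq_complex/= => /andP[/eqP ERe /eqP EIm].
have uV0 y : 0 <= psi (cmod (u + V y) / l) by exact: orlicz_cmod_ge0.
have := cmod_ge0 u; rewrite le_eqVlt => /predU1P[<-|r0].
  rewrite mul0r (orlicz_at0 psiP); apply: integral_ge0 => y _.
  by rewrite lee_fin.
set r := cmod u in r0 *; have a0 : 0 < r / l by rewrite divr_gt0.
have [m m0 mP] := orlicz_support psiP a0.
(* The coordinates of the unit vector [u / r], times the slope [m / l]. *)
pose al := m * complex.Re u / (l * r); pose be := m * complex.Im u / (l * r).
have low y : psi (r / l) + (al * complex.Re (V y) + be * complex.Im (V y)) <=
    psi (cmod (u + V y) / l).
  apply: le_trans (mP _ _); last by rewrite divr_ge0 ?cmod_ge0// ltW.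
  have cs : complex.Re u * complex.Re (u + V y) +
      complex.Im u * complex.Im (u + V y) <= r * cmod (u + V y).
    apply: (le_trans (ler_norm _)); rewrite -sqrtr_sqr /r !cmodE.
    rewrite -sqrtrM ?sqmod_ge0// ler_wsqrtr// /sqmod -subr_ge0.
    rewrite [leRHS](_ : _ = (complex.Re u * complex.Im (u + V y) -
      complex.Im u * complex.Re (u + V y)) ^+ 2) ?sqr_ge0//; ring.
  have rr : r ^+ 2 = complex.Re u ^+ 2 + complex.Im u ^+ 2 by exact: sqr_cmod.
  have c0 : 0 <= m / (l * r) by rewrite divr_ge0// mulr_ge0// ltW.
  have := ler_wpM2l c0 cs; rewrite ReD ImD.
  have -> : m / (l * r) * (r * cmod (u + V y)) = m * (cmod (u + V y) / l).
    by field; lra.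
  rewrite [X in X <= _ -> _](_ : _ = m / (l * r) * r ^+ 2 +
    (al * complex.Re (V y) + be * complex.Im (V y))); last first.
    by rewrite rr /al /be; field; lra.
  have -> : m / (l * r) * r ^+ 2 = m * (r / l) by field; lra.
  lra.
pose h (y : Y) := ((psi (r / l))%:E + (al%:E * (complex.Re (V y))%:E +
   be%:E * (complex.Im (V y))%:E))%E.
have ih1 : P.-integrable setT (fun y => (al%:E * (complex.Re (V y))%:E)%E).
  exact: integrableZl.
have ih2 : P.-integrable setT (fun y => (be%:E * (complex.Im (V y))%:E)%E).
  exact: integrableZl.
have ic : P.-integrable setT (fun _ => (psi (r / l))%:E).
  exact: finite_measure_integrable_cst.
have zero (f : Y -> R) : P.-integrable setT (EFin \o f) ->
    fine 'E_P[f] = 0 -> (\int[P]_y (f y)%:E = 0)%E.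
  move=> intf; rewrite unlock => Ef.
  by rewrite -[LHS]fineK ?Ef//; exact: integrable_fin_num.
have hE : (\int[P]_y h y = (psi (r / l))%:E)%E.
  rewrite integralD//; last exact: integrableD.
  rewrite integralD// !integralZl// (zero _ iRe ERe) (zero _ iIm EIm).
  rewrite !mule0 !adde0.
  rewrite (integral_cst P measurableT (psi (r / l))%:E).
  by rewrite [X in (_ * X)%E](probability_setT P) mule1.
have hlow y : (h y <= (psi (cmod (u + V y) / l))%:E)%E.
  by rewrite /h -!EFinM -!EFinD lee_fin low.
have mh : measurable_fun setT h.
  by have /measurable_int : P.-integrable setT h by do 2?apply: integrableD.
(* [h] may be negative and the right-hand integral infinite; passing to the positive part leaves a
   comparison of nonnegative functions. *)
rewrite -hE integralE; apply: (@le_trans _ _ (\int[P]_y h^\+ y)%E).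
  by rewrite -[leRHS]sube0 leeB// integral_ge0.
apply: ge0_le_integral => //.
- exact: measurable_funepos.
- apply/measurable_EFinP; apply: measurable_orlicz_cmod => //.
  by apply: complex_measurableD => //; exact: complex_measurable_cst.
- by move=> y _; rewrite funeposE ge_max hlow lee_fin uV0.
Qed.

(** Independence makes the joint law the product of the two laws. By Tonelli the integral over [V]
    can be taken first with the value of [U] frozen, where [jensen_translate] applies. *)
Lemma orlicz_integral_le_indep (U V : Y -> R[i]) (l : R) : 0 < l ->
  complex_measurable U -> complex_measurable V -> complex_integrable P V ->
  complex_expectation P V = 0 ->
  (forall A B : set (R * R), measurable A -> measurable B ->
    P ([set y | A (complex_pair (U y))] `&` [set y | B (complex_pair (V y))]) =
    P [set y | A (complex_pair (U y))] *
    P [set y | B (complex_pair (V y))])%E ->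
  (\int[P]_y (psi (cmod (U y) / l))%:E <=
   \int[P]_y (psi (cmod (U y + V y) / l))%:E)%E.
Proof.
move=> l0 mU mV iV EV indep.
pose toC (p : R * R) : R[i] := p.1 +i* p.2.
have toCK z : toC (complex_pair z) = z by case: z.
have mtoC : complex_measurable toC.
  by apply/complex_measurableP; split; [exact: measurable_fst|exact: measurable_snd].
pose f (p : R * R) := (psi (cmod (toC p) / l))%:E.
pose g (p : (R * R) * (R * R)) := (psi (cmod (toC p.1 + toC p.2) / l))%:E.
have mf : measurable_fun setT f.
  by apply/measurable_EFinP; exact: measurable_orlicz_cmod.
have mg : measurable_fun setT g.
  apply/measurable_EFinP; apply: measurable_orlicz_cmod => //.
  apply: complex_measurableD.
    exact: (measurableT_comp mtoC measurable_fst).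
  exact: (measurableT_comp mtoC measurable_snd).
have f0 p : (0 <= f p)%E.
  by rewrite lee_fin; exact: orlicz_cmod_ge0.
have g0 p : (0 <= g p)%E.
  by rewrite lee_fin; exact: orlicz_cmod_ge0.
pose pU : {mfun Y >-> (R * R)%type} := mfun_Sub (mem_set mU).
pose pV : {mfun Y >-> (R * R)%type} := mfun_Sub (mem_set mV).
pose pUV : {mfun Y >-> ((R * R) * (R * R))%type} :=
  mfun_Sub (mem_set (measurable_fun_pair mU mV)).
have -> : (\int[P]_y (psi (cmod (U y) / l))%:E = \int[distribution P pU]_p f p)%E.
  rewrite ge0_integral_distribution//.
  by apply: eq_integral => y _; rewrite /= /f toCK.
have -> : (\int[P]_y (psi (cmod (U y + V y) / l))%:E =
    \int[distribution P pUV]_p g p)%E.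
  rewrite ge0_integral_distribution//.
  by apply: eq_integral => y _; rewrite -{1}(toCK (U y)) -{1}(toCK (V y)).
(* The hypothesis gives equality on measurable rectangles, which determine the product measure. *)
have -> : (\int[distribution P pUV]_p g p =
    \int[(distribution P pU \x distribution P pV)]_p g p)%E.
  apply: eq_measure_integral => A mA _; apply/esym.
  by apply: product_measure_unique => // A1 A2 mA1 mA2; exact: indep.
rewrite fubini_tonelli1//; apply: ge0_le_integral => //.
- exact: measurable_fun_fubini_tonelli_F.
- move=> p _; rewrite /fubini_F ge0_integral_distribution//; last first.
    exact: measurableT_comp.
  rewrite (eq_integral (fun y => (psi (cmod (toC p + V y) / l))%:E)).
    exact: jensen_translate.
  by move=> y _; rewrite -[in RHS](toCK (V y)).
Qed.

End jensen.

(** * Independence of a subsum from one further variable *)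

Lemma complex_measurable_preim (R : realType) (d : measure_display)
    (Y : measurableType d) (f : Y -> R[i]) (A : set (R * R)) :
  complex_measurable f -> measurable A ->
  measurable [set y | A (complex_pair (f y))].
Proof. by move=> mf mA; have := mf measurableT A mA; rewrite setTI. Qed.

Section independence.
Context {R : realType} (d : measure_display) (Y : measurableType d).
Context (P : probability Y R) (N : nat) (X : 'I_N -> Y -> R[i]).
Hypotheses (mX : forall n, complex_measurable (X n)).
Hypothesis (indX : complex_independent P X).

(** For fixed [B] both sides are finite measures of the first event. They agree on the cylinders
    over [J], which are closed under intersection, hence on the generated sigma-algebra, and the
    subsum is measurable for it. *)
Lemma complex_independent_sum (J : {set 'I_N}) (m : 'I_N)
    (A B : set (R * R)) : m \notin J -> measurable A -> measurable B ->
  (P ([set y | A (complex_pair (\sum_(n in J) X n y)%R)] `&`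
      [set y | B (complex_pair (X m y))]) =
   P [set y | A (complex_pair (\sum_(n in J) X n y)%R)] *
   P [set y | B (complex_pair (X m y))])%E.
Proof.
move=> mJ mA mB.
pose cyl (E : 'I_N -> set (R * R)) :=
  \bigcap_(n in [set` J]) [set y | E n (complex_pair (X n y))].
pose G := [set S | exists2 E, (forall n, measurable (E n)) & S = cyl E].
have Gm : G `<=` measurable.
  move=> _ [E mE ->]; apply: fin_bigcap_measurable => //.
  by move=> n _; exact: complex_measurable_preim.
have GT : G setT.
  exists (fun=> setT) => //; apply/esym; rewrite -subTset => y _ n _.
  by [].
have GI : setI_closed G.
  move=> _ _ [E mE ->] [F mF ->]; exists (fun n => E n `&` F n).
    by move=> n; exact: measurableI.
  rewrite /cyl; apply/seteqP; split => y.
    by move=> [EJ FJ] n nJ; split; [exact: EJ|exact: FJ].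
  by move=> EF; split => n nJ; have [] := EF n nJ.
have mXB : measurable [set y | B (complex_pair (X m y))].
  exact: complex_measurable_preim.
have pB_fin : P [set y | B (complex_pair (X m y))] \is a fin_num.
  exact: fin_num_measure.
pose k : {nonneg R} :=
  NngNum (fine_ge0 (measure_ge0 P [set y | B (complex_pair (X m y))])).
pose m1 : {measure set Y -> \bar R} := mrestr P mXB.
pose m2 : {measure set Y -> \bar R} := mscale k P.
have m1E S : m1 S = P (S `&` [set y | B (complex_pair (X m y))]) by [].
have m2E S : m2 S = (P S * P [set y | B (complex_pair (X m y))])%E.
  by rewrite -(fineK pB_fin) muleC.
suff : m1 [set y | A (complex_pair (\sum_(n in J) X n y))] =
       m2 [set y | A (complex_pair (\sum_(n in J) X n y))].
  by rewrite m1E m2E.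
apply: (@g_sigma_algebra_measure_unique _ _ _ G Gm (fun=> setT) _ _ m1 m2) => //.
- by rewrite bigcup_const.
- move=> _ [E mE ->]; rewrite m1E m2E [in RHS]/cyl indX//.
  (* Placing [B] at the new index turns the intersection into a cylinder over [m |: J], to which the
     joint independence applies. *)
  pose E' n := if n == m then B else E n.
  have JmE : \bigcap_(n in [set` m |: J]) [set y | E' n (complex_pair (X n y))] =
      cyl E `&` [set y | B (complex_pair (X m y))].
    apply/seteqP; split => y.
      move=> EJ; split; last by have := EJ m; rewrite /E' /= eqxx setU11; apply.
      move=> n nJ; have := EJ n; rewrite /E' /=.
      by rewrite (negbTE (memPn mJ _ nJ)) setU1r//; apply.
    move=> [EJ Bm] n; rewrite /E' /=; case: eqVneq => [-> //|nm].
    by rewrite !inE (negbTE nm)/= => nJ; exact: EJ.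
  rewrite -/(cyl E) -JmE indX; last first.
    by move=> n _; rewrite /E'; case: ifP.
  rewrite big_setU1//= /E' eqxx muleC; congr (_ * _)%E.
  by apply: eq_bigr => n nJ; rewrite (negbTE (memPn mJ _ nJ)).
- move=> _; rewrite m1E setTI.
  by rewrite (le_lt_trans (probability_le1 P mXB))// ltry.
(* Each [X n] with [n] in [J] is measurable for the cylinder sigma-algebra: its preimages are
   cylinders with [setT] at the other indices. *)
have mG : @complex_measurable R _ (g_sigma_algebraType G)
    (fun y => \sum_(n in J) X n y).
  apply: complex_measurable_sum => n nJ _ S mS; rewrite setTI.
  apply: sub_sigma_algebra; exists (fun k => if k == n then S else setT).
    by move=> j; case: ifP.
  apply/seteqP; split => y.
    by move=> Sy j _ /=; case: eqP => [->|].
  by move=> /(_ n nJ) /=; rewrite eqxx.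
exact: (complex_measurable_preim mG mA).
Qed.

End independence.

(** * Subsums and sign changes of independent centered variables *)

Definition flip_sign {R : realType} (b : bool) (z : R[i]) : R[i] :=
  if b then - z else z.

Section signs.
Context {R : realType} (psi : R -> R) (psiP : orlicz_function psi).
Context (d : measure_display) (Y : measurableType d) (P : probability Y R).
Context (N : nat).
Implicit Types (X : 'I_N -> Y -> R[i]) (s : 'I_N -> bool).

Definition independent_centered X := [/\ forall n, complex_measurable (X n),
  complex_independent P X, forall n, complex_integrable P (X n) &
  forall n, complex_expectation P (X n) = 0].

(** For independence, the sign is moved from the variable to its test set, which is replaced by its
    reflection. *)
Lemma independent_centered_flip_sign X s : independent_centered X ->
  independent_centered (fun n y => flip_sign (s n) (X n y)).
Proof.
move=> [mX indX iX EX].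
pose neg (p : R * R) := (- p.1, - p.2).
have mneg : measurable_fun setT neg.
  by apply: measurable_fun_pair; exact: measurableT_comp.
have cpN z : complex_pair (- z : R[i]) = neg (complex_pair z) by case: z.
split.
- move=> n; rewrite /flip_sign; case: (s n) => //; exact: complex_measurableN.
- move=> J A mA.
  have E n : [set y | A n (complex_pair (flip_sign (s n) (X n y)))] =
      [set y | (if s n then neg @^-1` A n else A n) (complex_pair (X n y))].
    by apply/seteqP; rewrite /flip_sign; case: (s n); split => y /=; rewrite ?cpN.
  rewrite (eq_bigcapr (fun n _ => E n)) (indX J (fun n => if s n then neg @^-1` A n else A n)).
    by apply: eq_bigr => n _; rewrite E.
  move=> n nJ; case: (s n); last exact: mA.
  by rewrite -[X in measurable X]setTI; apply: mneg => //; exact: mA.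
- move=> n; rewrite /flip_sign; case: (s n) => //; have [iR iI] := iX n; split.
  + by under eq_fun do rewrite ReN EFinN; exact: integrableN.
  + by under eq_fun do rewrite ImN EFinN; exact: integrableN.
- move=> n; rewrite /flip_sign; case: (s n) => //; have [iR iI] := iX n.
  have := EX n => /eqP; rewrite eq_complex/= => /andP[/eqP ERe /eqP EIm].
  rewrite /complex_expectation.
  have eN (f : Y -> R) : P.-integrable setT (EFin \o f) ->
      fine 'E_P[f] = 0 -> fine 'E_P[(fun y => - f y)] = 0.
    move=> iF; rewrite !unlock => Ef.
    under eq_integral do rewrite EFinN.
    by rewrite integralN/= ?fineN ?Ef ?oppr0// integrable_add_def.
  rewrite (_ : (fun y => complex.Re _) = (fun y => - complex.Re (X n y))); last first.
    by apply/funext => y; rewrite ReN.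
  rewrite (_ : (fun y => complex.Im _) = (fun y => - complex.Im (X n y))); last first.
    by apply/funext => y; rewrite ImN.
  by rewrite !eN.
Qed.

(** The missing summands are restored one at a time, by induction on the size of the complement of
    [J]; each is independent of the current subsum and centered. *)
Lemma orlicz_integral_sum_sub X (J : {set 'I_N}) (l : R) : 0 < l ->
  independent_centered X ->
  (\int[P]_y (psi (cmod (\sum_(n in J) X n y)%R / l))%:E <=
   \int[P]_y (psi (cmod (\sum_n X n y)%R / l))%:E)%E.
Proof.
move=> l0 [mX indX iX EX]; have [k] := ubnP #|~: J|.
elim: k J => // k IH J; rewrite ltnS => Jk.
have [JT|] := eqVneq (~: J)%SET finset.set0.
  have -> : J = [set: 'I_N]%SET by rewrite -[J]finset.setCK JT finset.setC0.
  rewrite le_eqVlt; apply/orP; left; apply/eqP; apply: eq_integral => y _.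
  by congr ((psi (cmod _ / l))%:E); apply: eq_bigl => n; rewrite inE.
case/finset.set0Pn => m; rewrite inE => mJ.
apply: (@le_trans _ _
    (\int[P]_y (psi (cmod (\sum_(n in m |: J) X n y)%R / l))%:E)%E); last first.
  apply: IH; apply: leq_trans Jk.
  rewrite finset.setCU; apply: proper_card; rewrite finset.setIC -finset.setDE properD1// inE.
  by rewrite mJ.
rewrite [leRHS](eq_integral (fun y =>
    (psi (cmod (\sum_(n in J) X n y + X m y)%R / l))%:E)); last first.
  by move=> y _; rewrite big_setU1//= addrC.
apply: orlicz_integral_le_indep => //.
  exact: complex_measurable_sum.
by move=> A B mA mB; exact: complex_independent_sum.
Qed.

(** The signed sum is the subsum over the plus signs, indexed by [J], minus the one over the minus
    signs. The factor 2 turns this into a midpoint, so convexity gives half of each subsum's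
    integral, and [orlicz_integral_sum_sub] bounds both. *)
Lemma orlicz_integral_flip_sign X s (l : R) : 0 < l ->
  independent_centered X ->
  (\int[P]_y (psi (cmod (\sum_n flip_sign (s n) (X n y))%R / (2 * l)))%:E <=
   \int[P]_y (psi (cmod (\sum_n X n y)%R / l))%:E)%E.
Proof.
move=> l0 icX; have [mX indX iX EX] := icX.
pose J := [set n | ~~ s n]%SET.
pose S (K : {set 'I_N}) y := \sum_(n in K) X n y.
have mS K : complex_measurable (S K) by exact: complex_measurable_sum.
have mF K : measurable_fun setT (fun y => (psi (cmod (S K y) / l))%:E).
  by apply/measurable_EFinP; exact: measurable_orlicz_cmod.
have F0 K y : (0 <= (psi (cmod (S K y) / l))%:E)%E.
  by rewrite lee_fin; exact: orlicz_cmod_ge0.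
have split_sum y : \sum_n flip_sign (s n) (X n y) = S J y - S (~: J)%SET y.
  rewrite (bigID (fun n => n \in J))/= /S; congr (_ + _).
    by apply: eq_bigr => n; rewrite inE /flip_sign => /negbTE ->.
  rewrite -sumrN; apply: eq_big => n; first by rewrite finset.in_setC.
  by rewrite inE negbK /flip_sign => ->.
apply: (@le_trans _ _ (\int[P]_y (2^-1%:E *
   ((psi (cmod (S J y) / l))%:E + (psi (cmod (S (~: J)%SET y) / l))%:E)))%E).
  apply: ge0_le_integral => //.
  - by move=> y _; rewrite lee_fin; apply: orlicz_cmod_ge0; rewrite ?mulr_gt0.
  - apply/measurable_EFinP; apply: measurable_orlicz_cmod; rewrite ?mulr_gt0//.
    apply: complex_measurable_sum => n _; rewrite /flip_sign; case: (s n) => //.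
    exact: complex_measurableN.
  - by apply: measurable_funeM; exact: emeasurable_funD.
  - move=> y _; rewrite split_sum -EFinD -EFinM lee_fin [leRHS]mulrC.
    apply: le_trans (orlicz_half psiP _ _); [|by rewrite divr_ge0 ?cmod_ge0 ?ltW..].
    apply: (orlicz_mono psiP).
      by rewrite divr_ge0 ?cmod_ge0// mulr_ge0// ltW.
    rewrite -mulrDl -mulrA -invfM [l * 2]mulrC ler_wpM2r ?invr_ge0 ?mulr_ge0 ?(ltW l0)//.
    by rewrite -(cmodN (S (~: J)%SET y)) cmodD.
rewrite ge0_integralZl//; last 2 first.
- exact: emeasurable_funD.
- by move=> y _; rewrite adde_ge0.
rewrite ge0_integralD//.
have h1 := orlicz_integral_sum_sub J l0 icX.
have h2 := orlicz_integral_sum_sub (~: J)%SET l0 icX.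
apply: (le_trans (lee_wpmul2l _ (leeD h1 h2))); first by rewrite lee_fin.
set I := (\int[P]_y _)%E.
have I0 : (0 <= I)%E.
  by apply: integral_ge0 => y _; rewrite lee_fin; exact: orlicz_cmod_ge0.
rewrite ge0_muleDr// -ge0_muleDl// -EFinD.
have -> : 2^-1 + 2^-1 = 1 :> R by lra.
by rewrite mul1e.
Qed.

(** The previous inequality applied to the flipped variables, as a second flip restores the original
    ones. *)
Lemma orlicz_integral_unflip_sign X s (l : R) : 0 < l ->
  independent_centered X ->
  (\int[P]_y (psi (cmod (\sum_n X n y)%R / (2 * l)))%:E <=
   \int[P]_y (psi (cmod (\sum_n flip_sign (s n) (X n y))%R / l))%:E)%E.
Proof.
move=> l0 icX.
have := orlicz_integral_flip_sign s l0 (independent_centered_flip_sign s icX).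
have flipK y : \sum_n flip_sign (s n) (flip_sign (s n) (X n y)) = \sum_n X n y.
  by apply: eq_bigr => n _; rewrite /flip_sign; case: (s n); rewrite ?opprK.
by under eq_integral do rewrite flipK.
Qed.

End signs.

(** * Integrating averages over signs *)

Section averaging.
Context {R : realType} (d : measure_display) (Y : measurableType d).
Context (P : probability Y R) (F : R[i] -> R) (X : nat -> Y -> R[i]).
Hypotheses (F0 : forall z, 0 <= F z)
  (mF : forall g : Y -> R[i], complex_measurable g ->
     measurable_fun [set: Y] (F \o g))
  (mX : forall i, complex_measurable (X i)).

Lemma integral_rademacher_meanS n (f : Y -> R[i]) : complex_measurable f ->
  (\int[P]_y (rademacher_mean n.+1 F (f y) (X ^~ y))%:E = 2^-1%:E *
    (\int[P]_y (rademacher_mean n F (f y + X n y)%R (X ^~ y))%:E +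
     \int[P]_y (rademacher_mean n F (f y - X n y)%R (X ^~ y))%:E))%E.
Proof.
move=> mf.
have mD : measurable_fun setT
    (fun y => (rademacher_mean n F (f y + X n y) (X ^~ y))%:E).
  apply/measurable_EFinP; apply: measurable_rademacher_mean => //.
  exact: complex_measurableD.
have mB : measurable_fun setT
    (fun y => (rademacher_mean n F (f y - X n y) (X ^~ y))%:E).
  apply/measurable_EFinP; apply: measurable_rademacher_mean => //.
  by apply: complex_measurableD => //; exact: complex_measurableN.
have m0 a y : (0 <= (rademacher_mean n F a (X ^~ y))%:E)%E.
  by rewrite lee_fin rademacher_mean_ge0.
rewrite -ge0_integralD// -ge0_integralZl//.
- by apply: eq_integral => y _; rewrite /= mulrC EFinM EFinD.
- exact: emeasurable_funD.
- by move=> y _; rewrite adde_ge0.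
Qed.

Lemma flip_sign_sum_recr n (s : nat -> bool) (b : bool) y :
  \sum_(i < n.+1) flip_sign (if i == n :> nat then b else s i) (X i y) =
  flip_sign b (X n y) + \sum_(i < n) flip_sign (s i) (X i y).
Proof.
rewrite big_ord_recr/= eqxx addrC; congr (_ + _).
by apply: eq_bigr => i _; rewrite ltn_eqF.
Qed.

(** A bound that is uniform over the sign patterns passes to their average. The base function [f] is
    arbitrary so that the induction can absorb the last signed summand into it. *)
Lemma integral_rademacher_mean_le n (f : Y -> R[i]) (B : \bar R) :
  complex_measurable f -> (0 <= B)%E ->
  (forall s : nat -> bool,
    \int[P]_y (F (f y + \sum_(i < n) flip_sign (s i) (X i y))%R)%:E <= B)%E ->
  (\int[P]_y (rademacher_mean n F (f y) (X ^~ y))%:E <= B)%E.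
Proof.
move=> mf B0; elim: n f mf => [|n IH] f mf H.
  apply: le_trans (H xpred0); apply: ge0_le_integral => //=.
  - by move=> y _; rewrite lee_fin.
  - by apply/measurable_EFinP; exact: mF.
  - under eq_fun do rewrite big_ord0 addr0.
    by apply/measurable_EFinP; exact: mF.
  - by move=> y _; rewrite big_ord0 addr0.
rewrite integral_rademacher_meanS//.
have half (b : bool) : (\int[P]_y (rademacher_mean n F
    (f y + flip_sign b (X n y))%R (X ^~ y))%:E <= B)%E.
  apply: IH.
    apply: complex_measurableD => //; case: b => //=.
    exact: complex_measurableN.
  (* The pattern [s] on the first [n] indices is extended by [b] at index [n]. *)
  move=> s; have := H (fun i => if i == n then b else s i).
  by under eq_integral do rewrite flip_sign_sum_recr addrA.
apply: (le_trans (lee_wpmul2l _ (leeD (half false) (half true)))).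
  by rewrite lee_fin.
rewrite ge0_muleDr// -ge0_muleDl// -EFinD.
have -> : 2^-1 + 2^-1 = 1 :> R by lra.
by rewrite mul1e.
Qed.

Lemma integral_rademacher_mean_ge n (f : Y -> R[i]) (B : \bar R) :
  complex_measurable f -> (0 <= B)%E ->
  (forall s : nat -> bool,
    B <= \int[P]_y (F (f y + \sum_(i < n) flip_sign (s i) (X i y))%R)%:E)%E ->
  (B <= \int[P]_y (rademacher_mean n F (f y) (X ^~ y))%:E)%E.
Proof.
move=> mf B0; elim: n f mf => [|n IH] f mf H.
  apply: (le_trans (H xpred0)); apply: ge0_le_integral => //=.
  - by move=> y _; rewrite lee_fin.
  - under eq_fun do rewrite big_ord0 addr0.
    by apply/measurable_EFinP; exact: mF.
  - by apply/measurable_EFinP; exact: mF.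
  - by move=> y _; rewrite big_ord0 addr0.
rewrite integral_rademacher_meanS//.
have half (b : bool) : (B <= \int[P]_y (rademacher_mean n F
    (f y + flip_sign b (X n y))%R (X ^~ y))%:E)%E.
  apply: IH.
    apply: complex_measurableD => //; case: b => //=.
    exact: complex_measurableN.
  move=> s; have := H (fun i => if i == n then b else s i).
  by under eq_integral do rewrite flip_sign_sum_recr addrA.
apply: le_trans (lee_wpmul2l _ (leeD (half false) (half true))); last first.
  by rewrite lee_fin.
rewrite ge0_muleDr// -ge0_muleDl// -EFinD.
have -> : 2^-1 + 2^-1 = 1 :> R by lra.
by rewrite mul1e.
Qed.

End averaging.

(** * From integral inequalities to Luxemburg norms *)

Lemma luxemburg_norm_le_scale (R : realType) (d : measure_display)
    (Y : measurableType d) (P : probability Y R) (psi : R -> R)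
    (f g : Y -> R[i]) (K : R) : 0 < K ->
  (forall l : R, 0 < l -> (\int[P]_y (psi (cmod (g y) / l))%:E <= 1)%E ->
     (\int[P]_y (psi (cmod (f y) / (K * l)))%:E <= 1)%E) ->
  (luxemburg_norm P psi f <= K%:E * luxemburg_norm P psi g)%E.
Proof.
move=> K0 H; rewrite /luxemburg_norm -ereal_inf_pZl//.
apply: le_ereal_inf_tmp => _ [_ [l [l0 gl] <-] <-].
apply: ereal_inf_lbound; exists (K * l); last by rewrite EFinM.
by split; [rewrite mulr_gt0|exact: H].
Qed.

Section square_function_bounds.
Context {R : realType} (psi : R -> R) (psiP : orlicz_function psi).
Context (d : measure_display) (Y : measurableType d) (P : probability Y R).
Context (N : nat) (X : 'I_N.+1 -> Y -> R[i]) (icX : independent_centered P X).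

(** [rademacher_mean] takes a sequence over [nat]; [inord] needs a nonempty index type, whence
    ['I_N.+1]. *)
Let X' (i : nat) : Y -> R[i] := X (inord i).

Let mX' i : complex_measurable (X' i).
Proof. by have [mX _ _ _] := icX; exact: mX. Qed.

Let square_functionE y :
  cmod (square_function X y)%:C = Num.sqrt (\sum_(i < N.+1) sqmod (X' i y)).
Proof.
rewrite cmodR ger0_norm ?sqrtr_ge0//; congr Num.sqrt.
by apply: eq_bigr => i _; rewrite sqr_cmod /X' inord_val.
Qed.

Let flip_sign_sumE (s : nat -> bool) y :
  0 + \sum_(i < N.+1) flip_sign (s i) (X' i y) =
  \sum_(n < N.+1) flip_sign (s n) (X n y).
Proof. by rewrite add0r; apply: eq_bigr => i _; rewrite /X' inord_val. Qed.

Let mF (l : R) : 0 < l -> forall g : Y -> R[i], complex_measurable g ->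
  measurable_fun [set: Y] ((fun z => psi (cmod z / l)) \o g).
Proof. by move=> l0 g mg; exact: measurable_orlicz_cmod. Qed.

Let measurable_mean (l : R) : 0 < l -> measurable_fun [set: Y] (fun y =>
  (rademacher_mean N.+1 (fun z => psi (cmod z / l)) 0 (X' ^~ y))%:E).
Proof.
move=> l0; apply/measurable_EFinP.
apply: (@measurable_rademacher_mean _ _ _ _ _ (fun _ => 0)) => //.
  exact: mF.
exact: complex_measurable_cst.
Qed.

(** The constant is [2 * (9 / 5)]: the 2 comes from inserting signs, the 9/5 inverts the constant of
    [khintchine_lower]. *)
Lemma luxemburg_norm_square_function_le :
  (luxemburg_norm P psi (fun y => (square_function X y)%:C) <=
   (18 / 5)%:E * luxemburg_norm P psi (fun y => \sum_(n < N.+1) X n y)%R)%E.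
Proof.
apply: luxemburg_norm_le_scale => [|l l0 Sl]; first by lra.
have l20 : 0 < 2 * l by rewrite mulr_gt0.
have mean_le1 : (\int[P]_y (rademacher_mean N.+1
    (fun z => psi (cmod z / (2 * l))) 0 (X' ^~ y))%:E <= 1)%E.
  apply: (@integral_rademacher_mean_le _ _ _ P _ _ _ _ _ _ (fun _ => 0)) => //.
  - by move=> z; exact: orlicz_cmod_ge0.
  - exact: mF.
  - exact: complex_measurable_cst.
  - move=> s; under eq_integral do rewrite flip_sign_sumE.
    exact: (le_trans (orlicz_integral_flip_sign psiP _ l0 icX)).
apply: le_trans mean_le1; apply: ge0_le_integral => //.
- by move=> y _; rewrite lee_fin; apply: orlicz_cmod_ge0 => //; lra.
- apply/measurable_EFinP; apply: measurable_orlicz_cmod => //; first by lra.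
  by have [mX _ _ _] := icX; exact: complex_measurable_square_function.
- exact: measurable_mean.
- move=> y _; rewrite lee_fin square_functionE.
  have := khintchine_lower psiP N.+1 (X' ^~ y) l20.
  apply: le_trans; rewrite le_eqVlt; apply/orP; left; apply/eqP; congr psi.
  by field; lra.
Qed.

(** After integration, Khintchine bounds the average by [M = B * (1 + D)] instead of 1. As [1 <= M],
    enlarging the scale by [M] divides [psi] by at least [M], by [orlicz_scale]; the remaining 2
    comes from removing the signs. *)
Lemma luxemburg_norm_sum_le (B D : R) : 0 < B -> 1 <= B * (1 + D) -> 0 <= D ->
  (forall n (l : R) (x : nat -> R[i]), 0 < l ->
    rademacher_mean n (fun z => psi (cmod z / l)) 0 x <=
    B * (psi (Num.sqrt (\sum_(i < n) sqmod (x i)) / l) + D)) ->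
  (luxemburg_norm P psi (fun y => \sum_(n < N.+1) X n y)%R <=
   (2 * (B * (1 + D)))%:E *
     luxemburg_norm P psi (fun y => (square_function X y)%:C))%E.
Proof.
move=> B0 M1 D0 khin; set M := B * (1 + D) in M1 *.
have M0 : 0 < M by lra.
apply: luxemburg_norm_le_scale => [|l l0 Sl]; first by lra.
have Ml0 : 0 < M * l by rewrite mulr_gt0.
have msq : complex_measurable (fun y => (square_function X y)%:C).
  by have [mX _ _ _] := icX; exact: complex_measurable_square_function.
have mpsq : measurable_fun setT
    (fun y => (psi (cmod (square_function X y)%:C / l))%:E).
  by apply/measurable_EFinP; exact: measurable_orlicz_cmod.
have psq0 y : (0 <= (psi (cmod (square_function X y)%:C / l))%:E)%E.
  by rewrite lee_fin; exact: orlicz_cmod_ge0.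
apply: (@le_trans _ _ (\int[P]_y (rademacher_mean N.+1
    (fun z => psi (cmod z / (M * l))) 0 (X' ^~ y))%:E)%E).
  apply: (@integral_rademacher_mean_ge _ _ _ P _ _ _ _ _ _ (fun _ => 0)) => //.
  - by move=> z; exact: orlicz_cmod_ge0.
  - exact: mF.
  - exact: complex_measurable_cst.
  - apply: integral_ge0 => y _; rewrite lee_fin; apply: orlicz_cmod_ge0 => //.
    by rewrite -mulrA mulr_gt0.
  - move=> s; under [leRHS]eq_integral do rewrite flip_sign_sumE.
    by rewrite -mulrA; exact: orlicz_integral_unflip_sign.
apply: (@le_trans _ _ (\int[P]_y ((M^-1 * B)%:E *
    ((psi (cmod (square_function X y)%:C / l))%:E + D%:E)))%E).
  apply: ge0_le_integral => //.
  - move=> y _; rewrite lee_fin rademacher_mean_ge0// => z.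
    exact: orlicz_cmod_ge0.
  - exact: measurable_mean.
  - by apply: measurable_funeM; exact: emeasurable_funD.
  - move=> y _; rewrite -EFinD -EFinM lee_fin square_functionE.
    apply: (@le_trans _ _ (M^-1 *
        rademacher_mean N.+1 (fun z => psi (cmod z / l)) 0 (X' ^~ y))).
      (* The affine rule with only the coefficient [M^-1] nonzero pulls this factor out of the
         mean. *)
      have := rademacher_mean_affine N.+1 (fun z => psi (cmod z / l))
        (fun=> 0) 0 M^-1 0 0 (X' ^~ y).
      rewrite !mul0r add0r addr0 => <-; apply: rademacher_mean_le => z.
      rewrite add0r addr0 invfM mulrCA.
      apply: (orlicz_scale psiP); rewrite ?invr_ge0 ?(ltW M0) ?invf_le1//.
      by rewrite divr_ge0 ?cmod_ge0// ltW.
    by rewrite -mulrA ler_wpM2l ?invr_ge0 ?(ltW M0)// khin.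
rewrite ge0_integralZl//; last 3 first.
- exact: emeasurable_funD.
- by move=> y _; rewrite adde_ge0.
- by rewrite lee_fin mulr_ge0 ?invr_ge0 ?ltW.
rewrite ge0_integralD//.
rewrite (integral_cst P measurableT D%:E) [X in (_ + _ * X)%E](probability_setT P) mule1.
apply: (@le_trans _ _ ((M^-1 * B)%:E * (1 + D%:E))%E).
  by rewrite lee_wpmul2l ?leeD2r// lee_fin mulr_ge0 ?invr_ge0 ?ltW.
rewrite -EFinD -EFinM lee_fin -mulrA -/M mulVf//; lra.
Qed.

End square_function_bounds.

Unset Implicit Arguments.
Set Strict Implicit.

Theorem theorem3p2 (R : realType) (psi : R -> R)
  (psi_orlicz : orlicz_function psi)
  (psi_growth : exists C x0 : R, [/\ 0 < C, 0 <= x0 &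
     forall x : R, x0 <= x -> x <= C * psi (2 * x) /\ psi (2 * x) <= C * psi x]) :
  exists c_psi C_psi : R, [/\ 0 < c_psi, 0 < C_psi &
    forall (d : measure_display) (Y : measurableType d) (P : probability Y R)
      (N : nat) (X : 'I_N -> Y -> R[i]),
      (1 <= N)%N ->
      (forall n, complex_measurable (X n)) ->
      complex_independent P X ->
      (forall n, complex_integrable P (X n)) ->
      (forall n, complex_expectation P (X n) = 0) ->
      (c_psi%:E * luxemburg_norm P psi (fun y => (square_function X y)%:C)
         <= luxemburg_norm P psi (fun y => \sum_(n < N) X n y)%R)%E /\
      (luxemburg_norm P psi (fun y => \sum_(n < N) X n y)%R
         <= C_psi%:E *
            luxemburg_norm P psi (fun y => (square_function X y)%:C))%E].
Proof.
have [C [x0 [_ x00 growth]]] := psi_growth.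
have [B B1 khin] := khintchine_upper psi_orlicz x00
  (fun t xt => proj2 (growth t xt)).
have D0 : 0 <= psi (x0 + 1) by apply: (orlicz_ge0 psi_orlicz); lra.
have M1 : 1 <= B * (1 + psi (x0 + 1)) by nra.
(* The first witness inverts 18/5. In the second, [B] and [x0] were obtained from [psi] before any
   probability space is introduced. *)
exists (5 / 18), (2 * (B * (1 + psi (x0 + 1)))); split; [lra|lra|].
move=> d Y P [//|N] X _ mX indX iX EX.
have icX : independent_centered P X by split.
split; last by apply: luxemburg_norm_sum_le => //; lra.
have := luxemburg_norm_square_function_le psi_orlicz icX.
move=> /(lee_wpmul2l (_ : (0 <= (5 / 18)%:E)%E)) -/(_ _) /le_trans.
apply; first by rewrite lee_fin; lra.
rewrite muleA -EFinM (_ : 5 / 18 * (18 / 5) = 1) ?mul1e//; lra.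
Qed.
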